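(* Let $m\geq2$. The nontrivial Clifford--Fischer block of $C_m$ relative to $V_m$ is $$\mathcal{B}_{\mathrm{nz}}(C_m\mid V_m)=\bigl\{\widetilde\chi_{\mathrm{nz},\tau}:\tau\in\mathrm{Irr}(P_m)\bigr\},$$ indexed by the ordinary irreducible characters of its inertia factor $$H_2=I_{C_m}(\chi_{u_m})/V_m\simeq P_m,$$ with values in the fixed-point columns $(T,\ell)$ given by $$\widetilde\chi_{\mathrm{nz},\tau}(g)=\sum_{x\in F_T\setminus\{0\}}\ell_g(x)\,\chi_\tau(T_x^{-1}TT_x)\qquad(g=(T,\lambda_g)\in C_m,\ \ell=\ell_g=\lambda_g|_{F_T}).$$ No projective character table of $H_2$ is required.
   Context: **Setting.** $A=\mathbb{F}_2^m$ with basis $e_1,\dots,e_m$, and $A^*=\mathrm{Hom}_{\mathbb{F}_2}(A,\mathbb{F}_2)$, identified with $\widehat{A}=\mathrm{Hom}(A,U(1))$ by $\xi\mapsto(x\mapsto(-1)^{\xi(x)})$. $V_m=A\oplus A^*$, with symplectic form $\langle(x,\xi),(y,\eta)\rangle=\xi(y)+\eta(x)\in\mathbb{F}_2$ and bicharacter $\beta((x,\xi),(y,\eta))=(-1)^{\xi(y)}$. $\mathrm{Sp}(V_m)\simeq\mathrm{Sp}(2m,2)$ is the isometry group of $\langle\cdot,\cdot\rangle$. It has exactly two orbits on $V_m$: $\{0\}$ and $V_m\setminus\{0\}$. **Clifford group $C_m=C(\mathbb{F}_2^m)$.** Let $\mathcal{H}=\mathbb{C}[A]$ with orthonormal basis $|b\rangle$,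 $b\in A$; for $v=(a,\xi)\in V_m$ let $W_v|b\rangle=(-1)^{\xi(b)}|a+b\rangle$; $C_m$ is the normalizer in $U(\mathcal{H})$ of $\{zW_v:z\in U(1),v\in V_m\}$ modulo $U(1)\cdot I$. It is identified (by a known isomorphism) with the group of pairs $(T,\lambda)$, $T\in\mathrm{Aut}(V_m)$, $\lambda:V_m\to U(1)$ a function with $\lambda(u+v)\lambda(u)^{-1}\lambda(v)^{-1}=\beta(Tu,Tv)\beta(u,v)^{-1}$ for all $u,v$, with product $(T,\lambda)(S,\mu)=(TS,\lambda^S\mu)$, $\lambda^S(u)=\lambda(Su)$. Necessarily $T\in\mathrm{Sp}(V_m)$, and $1\to V_m\to C_m\to\mathrm{Sp}(V_m)\to1$ is exact, where $v\in V_m$ is sent to $K_v=(\mathrm{id},x\mapsto(-1)^{\langle v,x\rangle})$. For $m\geq2$ this extension is nonsplit. **Affine group and functor $\mathcal{F}$.** $\mathrm{ASp}(A)=\{(T,\chi):T\in\mathrm{Sp}(V_m),\chi\in\widehat{V_m}\}$ with $(T,\chi)(S,\psi)=(TS,\chi^S\psi)$, $\chi^S(v)=\chi(Sv)$. For a finite-dimensional complex representation $(U,\pi)$ of $\mathrm{ASp}(A)$, $U=\bigoplus_{v\in V_m}U_v$ with $U_v=\{\xi:\pi(\mathrm{id},\chi)\xi=\chi(v)\xi\ \forall\chi\}$; $\mathcal{F}(U)$ is the same vector space with $C_m$-action $(T,\lambda)\cdot\xi=\lambda(v)\pi(T,1)\xi$ for $\xi\in U_v$. **Characters.** $u_m=(e_1,0)\in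 V_m$, $P_m=\mathrm{Stab}_{\mathrm{Sp}(V_m)}(u_m)$. For $\tau\in\mathrm{Irr}(P_m)$ with character $\chi_\tau$, let $\Pi(u_m,\tau)$ be the representation of $\mathrm{ASp}(A)$ induced from the representation $(T,\chi)\mapsto\chi(u_m)\tau(T)$ of $P_m\ltimes\widehat{V_m}$; $\widetilde\chi_{\mathrm{nz},\tau}$ is the character of $\mathcal{F}(\Pi(u_m,\tau))$. For $x\in V_m\setminus\{0\}$, $T_x\in\mathrm{Sp}(V_m)$ is any chosen element with $T_xu_m=x$. For $T\in\mathrm{Sp}(V_m)$, $F_T=\ker(T-\mathrm{id})$; for $g=(T,\lambda_g)$ the restriction $\ell_g=\lambda_g|_{F_T}$ is a character of $F_T$, and the conjugacy class of $g$ is parametrized by the column $(T,\ell_g)$, modulo $S\cdot(T,\ell)=(STS^{-1},\ell\circ S^{-1})$, $S\in\mathrm{Sp}(V_m)$. **Clifford--Fischer terminology.** For $v\in V_m$, $\chi_v\in\mathrm{Irr}(V_m)$ is $\chi_v(x)=(-1)^{\langle v,x\rangle}$. The irreducible characters of $C_m$ are divided into blocks indexed by the $C_m$-orbits on $\mathrm{Irr}(V_m)$; the nontrivial block $\mathcal{B}_{\mathrm{nz}}(C_m\mid V_m)$ consists of the irreducible characters of $C_m$ whose restriction to $V_m$ involves the orbit of $\chi_{u_m}$. $I_{C_m}(\chi_{u_m})=\{g\in C_m:{}^g\chi_{u_m}=\chi_{u_m}\}$ is the inertia group, and its quotient by $V_m$ is the inertia factor $H_2$. In general the Clifford--Fischer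 construction of a block may require a projective character table of the inertia factor with a nontrivial factor set, which happens only if the orbit representative in $\mathrm{Irr}(V_m)$ does not extend to an ordinary character of its inertia group; ''no projective character table is required'' means that $\chi_{u_m}$ extends to an ordinary character of $I_{C_m}(\chi_{u_m})$ (its factor set on $H_2$ is a coboundary), so ordinary characters of $H_2$ suffice. *)

(* Defs.v *)
From HB Require Import structures.
From mathcomp Require Import all_boot all_order all_fingroup all_algebra.
From mathcomp Require Import all_solvable all_field all_character.

Set Implicit Arguments.
Unset Strict Implicit.
Unset Printing Implicit Defensive.

Import GroupScope Order.TTheory GRing.Theory Num.Theory.
Local Open Scope ring_scope.

(* V_m = A (+) A^* with A = F_2^m.  Vectors are rows; a linear form xi on A is
   the column of its values on the standard basis, so xi(x) = x *m xi.         *)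
Definition V (m : nat) : Type := ('rV['F_2]_m * 'cV['F_2]_m)%type.
HB.instance Definition _ m := GRing.Zmodule.on (V m).
HB.instance Definition _ m := Finite.on (V m).

Definition ev m (xi : 'cV['F_2]_m) (x : 'rV['F_2]_m) : 'F_2 := (x *m xi) 0 0.

Definition sgn (c : 'F_2) : algC := (-1) ^+ c.

Definition form m (u v : V m) : 'F_2 := ev u.2 v.1 + ev v.2 u.1.

Definition beta m (u v : V m) : algC := sgn (ev u.2 v.1).

(* u_m *)
Definition uvec m : V m := (\row_j (val j == 0)%:R, 0).

Lemma evDl m (xi eta : 'cV_m) x : ev (xi + eta) x = ev xi x + ev eta x.
Proof. by rewrite /ev mulmxDr mxE. Qed.

Lemma evDr m (xi : 'cV_m) x y : ev xi (x + y) = ev xi x + ev xi y.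
Proof. by rewrite /ev mulmxDl mxE. Qed.

Lemma ev0r m (xi : 'cV_m) : ev xi 0 = 0.
Proof. by rewrite /ev mul0mx mxE. Qed.

Lemma ev0l m (x : 'rV_m) : ev 0 x = 0.
Proof. by rewrite /ev mulmx0 mxE. Qed.

Lemma sgnD c d : sgn (c + d) = sgn c * sgn d.
Proof.
case: c d => [[|[|[]]]] // ic [[|[|[]]]] // id; rewrite /sgn /=;
  by rewrite ?expr0 ?expr1 ?mulr1 ?mul1r ?mulrNN ?mulr1.
Qed.

Lemma sgn0 : sgn 0 = 1. Proof. by []. Qed.

Lemma sgn_sq c : sgn c * sgn c = 1.
Proof. by rewrite /sgn -exprMn mulrNN mulr1 expr1n. Qed.

Lemma sgnV c : (sgn c)^-1 = sgn c.
Proof. by rewrite /sgn -exprVn invrN1. Qed.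

Lemma sgn_neq0 c : sgn c != 0.
Proof. by rewrite /sgn signr_eq0. Qed.

Lemma norm_sgn c : `|sgn c| = 1.
Proof. by rewrite /sgn normr_sign. Qed.

Lemma sgn_pm c : sgn c = 1 \/ sgn c = -1.
Proof.
by case: c => [[|[|[]]]] // ic; rewrite /sgn /= ?expr0 ?expr1; [left | right].
Qed.

Lemma sgn_inj : injective sgn.
Proof.
case=> [[|[|[]]]] // ic [[|[|[]]]] // id; rewrite /sgn /= ?expr0 ?expr1.
- by move=> _; apply: val_inj.
- by move/eqP; rewrite eq_sym eqNr oner_eq0.
- by move/eqP; rewrite eqNr oner_eq0.
- by move=> _; apply: val_inj.
Qed.

Lemma F2_addrr (c : 'F_2) : c + c = 0.
Proof. by case: c => [[|[|[]]]] // ic; apply: val_inj. Qed.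

Lemma V_addrr m (v : V m) : v + v = 0.
Proof.
case: v => a xi; congr pair; apply/matrixP=> i j;
  by rewrite !mxE F2_addrr.
Qed.

Lemma formC m (u v : V m) : form u v = form v u.
Proof. by rewrite /form addrC. Qed.

Lemma formDr m (u v w : V m) : form u (v + w) = form u v + form u w.
Proof. by rewrite /form /= evDr evDl addrACA. Qed.

Lemma form0r m (u : V m) : form u 0 = 0.
Proof. by rewrite /form ev0r ev0l addr0. Qed.

Lemma form_nondeg m (v : V m) : v != 0 -> exists w, form w v != 0.
Proof.
case: v => a xi nz.
have [j ja|a0] := pickP (fun j => a 0 j != 0).
  exists (0, delta_mx j 0); rewrite /form ev0r addr0 /ev /=.
  by rewrite -colE mxE.
have [j ja|x0] := pickP (fun j => xi j 0 != 0).
  exists (delta_mx 0 j, 0); rewrite /form ev0l add0r /ev /=.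
  by rewrite -rowE mxE.
case/negP: nz; apply/eqP; congr pair; apply/matrixP=> i j; rewrite mxE ord1.
  by apply/eqP; move/negbFE: (a0 j).
by apply/eqP; move/negbFE: (x0 i).
Qed.

(* Aut(V_m), with the product (T * S) v = T (S v); the product of permutations
   of MathComp composes in the other order.                                    *)
Definition additive_perm m (s : {perm V m}) :=
  [forall u, forall v, s (u + v) == s u + s v].

Record autV (m : nat) :=
  AutV { autV_perm : {perm V m}; autV_add : additive_perm autV_perm }.

Definition autV_fun m (T : autV m) : V m -> V m := autV_perm T.
Coercion autV_fun : autV >-> Funclass.

HB.instance Definition _ m := [isSub for @autV_perm m].
HB.instance Definition _ m := [Finite of autV m by <:].

Lemma autVD m (T : autV m) u v : T (u + v) = T u + T v.
Proof. exact/eqP/(forallP (forallP (autV_add T) u)). Qed.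

Lemma autV0 m (T : autV m) : T 0 = 0.
Proof. by apply: (addrI (T 0)); rewrite -autVD !addr0. Qed.

Section AutGroup.
Variable m : nat.
Implicit Types T S : autV m.

Fact autV_one_subproof : @additive_perm m 1%g.
Proof. by apply/forallP=> u; apply/forallP=> v; rewrite !perm1. Qed.

Fact autV_mul_subproof T S : additive_perm (autV_perm S * autV_perm T)%g.
Proof.
by apply/forallP=> u; apply/forallP=> v; rewrite !permM -!/(autV_fun _ _) !autVD.
Qed.

Fact autV_inv_subproof T : additive_perm (autV_perm T)^-1%g.
Proof.
apply/forallP=> u; apply/forallP=> v; apply/eqP/(@perm_inj _ (autV_perm T)).
by rewrite permKV -/(autV_fun _ _) autVD /autV_fun !permKV.
Qed.

Definition autV_one := AutV autV_one_subproof.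
Definition autV_mul T S := AutV (autV_mul_subproof T S).
Definition autV_inv T := AutV (autV_inv_subproof T).

Fact autV_mulA : associative autV_mul.
Proof. by move=> T S R; apply: val_inj; rewrite /= mulgA. Qed.
Fact autV_mul1 : left_id autV_one autV_mul.
Proof. by move=> T; apply: val_inj; rewrite /= mulg1. Qed.
Fact autV_mulV : left_inverse autV_one autV_inv autV_mul.
Proof. by move=> T; apply: val_inj; rewrite /= mulgV. Qed.

HB.instance Definition _ :=
  Finite_isGroup.Build (autV m) autV_mulA autV_mul1 autV_mulV.

End AutGroup.

Arguments autV_one : simpl never.
Arguments autV_mul : simpl never.
Arguments autV_inv : simpl never.

Lemma autVM m (T S : autV m) v : (T * S)%g v = T (S v).
Proof. by rewrite /autV_fun permM. Qed.

Lemma autV1 m v : (1%g : autV m) v = v.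
Proof. by rewrite /autV_fun perm1. Qed.

Lemma autVK m (T : autV m) : cancel T (T^-1)%g.
Proof. by move=> v; rewrite -autVM mulVg autV1. Qed.

Lemma autVKV m (T : autV m) : cancel (T^-1)%g T.
Proof. by move=> v; rewrite -autVM mulgV autV1. Qed.

Lemma autVP m (T S : autV m) : T =1 S -> T = S.
Proof. by move=> eTS; apply/val_inj/permP. Qed.

Definition Sp_set m : {set autV m} :=
  [set T : autV m | [forall u, forall v, form (T u) (T v) == form u v]].

Lemma SpP m (T : autV m) :
  reflect (forall u v, form (T u) (T v) = form u v) (T \in Sp_set m).
Proof.
rewrite inE; apply: (iffP forallP) => [h u v | h u].
  exact/eqP/(forallP (h u)).
by apply/forallP=> v; rewrite h.
Qed.

Fact Sp_group_set m : group_set (Sp_set m).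
Proof.
apply/group_setP; split; first by apply/SpP=> u v; rewrite !autV1.
by move=> T S /SpP hT /SpP hS; apply/SpP=> u v; rewrite !autVM hT hS.
Qed.
Canonical Sp m := Group (Sp_group_set m).

Definition P_set m : {set autV m} := [set T in Sp m | T (uvec m) == uvec m].

Fact P_group_set m : group_set (P_set m).
Proof.
apply/group_setP; split; first by apply/setIdP; rewrite group1 autV1.
move=> T S /setIdP[hT /eqP uT] /setIdP[hS /eqP uS]; apply/setIdP.
by rewrite groupM // autVM uS uT.
Qed.
Canonical P m := Group (P_group_set m).

(* Pairs (T, f) with f : V_m -> C, with (T, f)(S, h) = (T S, f^S h),
   f^S(u) = f(S u).                                                            *)
Definition pairs m := (autV m * {ffun V m -> algC})%type.

Definition pair_mul m (p q : pairs m) : pairs m :=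
  ((p.1 * q.1)%g, [ffun v => p.2 (q.1 v) * q.2 v]).
Definition pair_one m : pairs m := (1%g, [ffun => 1]).
Definition pair_inv m (p : pairs m) : pairs m :=
  ((p.1^-1)%g, [ffun v => (p.2 ((p.1^-1)%g v))^-1]).

Lemma pair_mulA m : associative (@pair_mul m).
Proof.
case=> T f [S h] [R k]; congr pair; rewrite /= ?mulgA //.
by apply/ffunP=> v; rewrite !ffunE mulrA autVM.
Qed.

Lemma pair_mul1 m : left_id (pair_one m) (@pair_mul m).
Proof.
case=> T f; congr pair; rewrite /= ?mul1g //.
by apply/ffunP=> v; rewrite !ffunE mul1r.
Qed.

Lemma pair_mulV m (p : pairs m) :
  (forall v, p.2 v != 0) -> pair_mul (pair_inv p) p = pair_one m.
Proof.
case: p => T f /= nzf; congr pair; rewrite /= ?mulVg //.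
by apply/ffunP=> v; rewrite !ffunE autVK mulVf.
Qed.

Definition unitary m (f : {ffun V m -> algC}) := [forall v, `|f v| == 1].

Lemma unitaryP m (f : {ffun V m -> algC}) :
  reflect (forall v, `|f v| = 1) (unitary f).
Proof. by apply: (iffP forallP) => h v; apply/eqP. Qed.

Lemma unitary_neq0 m (f : {ffun V m -> algC}) v : unitary f -> f v != 0.
Proof. by move/unitaryP=> h; rewrite -normr_eq0 h oner_eq0. Qed.

(* The elements of the Clifford group C_m, in its realization by pairs (T, lambda). *)
Definition clifford_pred m (p : pairs m) : bool :=
  unitary p.2 &&
  [forall u, forall v, p.2 (u + v) * (p.2 u)^-1 * (p.2 v)^-1
                       == beta (p.1 u) (p.1 v) * (beta u v)^-1].

(* The elements of ASp(A). *)
Definition asp_pred m (p : pairs m) : bool :=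
  [&& p.1 \in Sp m, unitary p.2
    & [forall u, forall v, p.2 (u + v) == p.2 u * p.2 v]].

Lemma clifford_predP m (p : pairs m) :
  reflect (unitary p.2 /\ forall u v,
     p.2 (u + v) = beta (p.1 u) (p.1 v) * beta u v * (p.2 u * p.2 v))
    (clifford_pred p).
Proof.
apply: (iffP andP) => -[Up h]; split=> //.
  move=> u v; have /eqP := forallP (forallP h u) v.
  have nu := unitary_neq0 u Up; have nv := unitary_neq0 v Up.
  by rewrite /beta sgnV => <-; rewrite [p.2 u * _]mulrC mulrA !mulfVK.
apply/forallP=> u; apply/forallP=> v; rewrite h.
have nu := unitary_neq0 u Up; have nv := unitary_neq0 v Up.
by rewrite [p.2 u * _]mulrC mulrA !mulfK // /beta sgnV.
Qed.

Lemma asp_predP m (p : pairs m) :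
  reflect [/\ p.1 \in Sp m, unitary p.2 & forall u v, p.2 (u + v) = p.2 u * p.2 v]
    (asp_pred p).
Proof.
apply: (iffP and3P) => -[h1 h2 h3]; split=> //.
  by move=> u v; apply/eqP/(forallP (forallP h3 u)).
by apply/forallP=> u; apply/forallP=> v; rewrite h3.
Qed.

(* The U(1)-valued components are forced to be 4th roots of unity in both
   groups, so both groups are finite.                                          *)
Definition roots4 : seq algC := [:: 1; -1; 'i; - 'i].

Lemma roots4P (z : algC) : z * z = 1 \/ z * z = -1 -> z \in roots4.
Proof.
rewrite -!expr2 => -[/eqP | /eqP].
  by rewrite sqrf_eq1 !inE => /orP[] ->; rewrite ?orbT.
by rewrite -sqrCi eqf_sqr !inE => /orP[] ->; rewrite ?orbT.
Qed.

Lemma clifford_roots m (p : pairs m) v : clifford_pred p -> p.2 v \in roots4.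
Proof.
case/clifford_predP=> Up h; apply: roots4P.
have p0: p.2 0 = 1.
  have := h 0 0; rewrite autV0 addr0 /beta !ev0r sgn0 !mul1r => e.
  by apply: (mulfI (unitary_neq0 0 Up)); rewrite mulr1 -e.
have := h v v; rewrite V_addrr p0 /beta -sgnD.
case: (sgn_pm (ev (p.1 v).2 (p.1 v).1 + ev v.2 v.1)) => ->.
  by rewrite mul1r; left.
by rewrite mulN1r => e; right; rewrite e opprK.
Qed.

Lemma asp_roots m (p : pairs m) v : asp_pred p -> p.2 v \in roots4.
Proof.
case/asp_predP=> _ Up h; apply: roots4P; left; rewrite -h V_addrr.
by apply: (mulfI (unitary_neq0 0 Up)); rewrite mulr1 -h addr0.
Qed.

Definition code m (p : pairs m) : autV m * {ffun V m -> 'I_5} :=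
  (p.1, [ffun v => inord (index (p.2 v) roots4)]).
Definition decode m (c : autV m * {ffun V m -> 'I_5}) : pairs m :=
  (c.1, [ffun v => roots4`_(c.2 v)]).

Lemma codeK m (p : pairs m) : (forall v, p.2 v \in roots4) -> decode (code p) = p.
Proof.
case: p => T f h; congr pair; apply/ffunP=> v; rewrite !ffunE inordK.
  by rewrite nth_index //; apply: h.
by rewrite ltnS index_size.
Qed.

Record clifford (m : nat) :=
  Clifford { cpair : pairs m; cpairP : clifford_pred cpair }.
Record asp (m : nat) :=
  Asp { apair : pairs m; apairP : asp_pred apair }.

Definition cT m (g : clifford m) : autV m := (cpair g).1.
Definition lam m (g : clifford m) : V m -> algC := (cpair g).2.
Definition aT m (g : asp m) : autV m := (apair g).1.
Definition achi m (g : asp m) : V m -> algC := (apair g).2.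

HB.instance Definition _ m := [isSub for @cpair m].
HB.instance Definition _ m := [Choice of clifford m by <:].
HB.instance Definition _ m := [isSub for @apair m].
HB.instance Definition _ m := [Choice of asp m by <:].

Fact clifford_codeK m :
  pcancel (fun g : clifford m => code (cpair g)) (fun c => insub (decode c)).
Proof.
move=> g; rewrite codeK; first exact: valK.
by move=> v; apply/clifford_roots/cpairP.
Qed.
HB.instance Definition _ m := PCanIsCountable (@clifford_codeK m).
HB.instance Definition _ m : isFinite (clifford m) := PCanIsFinite (@clifford_codeK m).

Fact asp_codeK m :
  pcancel (fun g : asp m => code (apair g)) (fun c => insub (decode c)).
Proof.
move=> g; rewrite codeK; first exact: valK.
by move=> v; apply/asp_roots/apairP.
Qed.
HB.instance Definition _ m := PCanIsCountable (@asp_codeK m).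
HB.instance Definition _ m : isFinite (asp m) := PCanIsFinite (@asp_codeK m).

Section CliffordGroup.
Variable m : nat.
Implicit Types g h : clifford m.

Fact clifford_one_subproof : clifford_pred (pair_one m).
Proof.
apply/clifford_predP; split=> [|u v /=].
  by apply/unitaryP=> v; rewrite ffunE normr1.
by rewrite !autV1 !ffunE !mulr1 /beta sgn_sq.
Qed.

Fact clifford_mul_subproof g h : clifford_pred (pair_mul (cpair g) (cpair h)).
Proof.
case: g h => [[T f] /= /clifford_predP[/= Uf hf]].
case=> [[S k] /= /clifford_predP[/= Uk hk]].
apply/clifford_predP; split=> [|u v /=].
  apply/unitaryP=> v; rewrite ffunE normrM.
  by rewrite (unitaryP _ Uf) (unitaryP _ Uk) mulr1.
rewrite !ffunE /= !autVM autVD hf hk.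
rewrite mulrACA [f _ * f _ * _]mulrACA; congr (_ * _).
by rewrite mulrA -[_ * _ * beta (S u) (S v)]mulrA sgn_sq mulr1.
Qed.

Fact clifford_inv_subproof g : clifford_pred (pair_inv (cpair g)).
Proof.
case: g => [[T f] /= /clifford_predP[/= Uf hf]].
apply/clifford_predP; split=> [|u v /=].
  by apply/unitaryP=> v; rewrite ffunE normfV (unitaryP _ Uf) invr1.
rewrite !ffunE autVD hf !autVKV !invfM /beta !sgnV.
by rewrite [sgn _ * sgn _]mulrC.
Qed.

Definition clifford_one := Clifford clifford_one_subproof.
Definition clifford_mul g h := Clifford (clifford_mul_subproof g h).
Definition clifford_inv g := Clifford (clifford_inv_subproof g).

Fact clifford_mulA : associative clifford_mul.
Proof. by move=> g h k; apply: val_inj; apply: pair_mulA. Qed.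
Fact clifford_mul1 : left_id clifford_one clifford_mul.
Proof. by move=> g; apply: val_inj; apply: pair_mul1. Qed.
Fact clifford_mulV : left_inverse clifford_one clifford_inv clifford_mul.
Proof.
move=> g; apply: val_inj; apply: pair_mulV => v.
by case/clifford_predP: (cpairP g) => Uf _; apply: unitary_neq0.
Qed.

HB.instance Definition _ :=
  Finite_isGroup.Build (clifford m) clifford_mulA clifford_mul1 clifford_mulV.

Lemma cTM g h : cT (g * h)%g = (cT g * cT h)%g. Proof. by []. Qed.
Lemma lamM g h v : lam (g * h)%g v = lam g (cT h v) * lam h v.
Proof. by rewrite /lam ffunE. Qed.
Lemma cT1 : cT (1%g : clifford m) = 1%g. Proof. by []. Qed.
Lemma lam1 v : lam (1%g : clifford m) v = 1. Proof. by rewrite /lam ffunE. Qed.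

Lemma clifford_ext g h : cT g = cT h -> lam g =1 lam h -> g = h.
Proof.
case: g h => [[T f] gP] [[S k] hP]; rewrite /cT /lam /= => eT ef.
by apply: val_inj; congr pair => //; apply/ffunP.
Qed.

Lemma lamP g u v :
  lam g (u + v) = beta (cT g u) (cT g v) * beta u v * (lam g u * lam g v).
Proof. by case/clifford_predP: (cpairP g) => _; apply. Qed.

Lemma lam_neq0 g v : lam g v != 0.
Proof. by case/clifford_predP: (cpairP g) => Uf _; apply: unitary_neq0. Qed.

Lemma cT_Sp g : cT g \in Sp m.
Proof.
apply/SpP=> u v; apply: sgn_inj.
have: beta (cT g u) (cT g v) * beta u v = beta (cT g v) (cT g u) * beta v u.
  apply: (mulIf (mulf_neq0 (lam_neq0 g u) (lam_neq0 g v))).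
  by rewrite -lamP addrC lamP [lam g v * _]mulrC.
rewrite /form !sgnD /beta; set a := sgn _; set b := sgn _; set c := sgn _.
set d := sgn _ => e; apply: (mulIf (sgn_neq0 (ev u.2 v.1))).
by rewrite -/b mulrAC e mulrAC /c sgn_sq mul1r mulrAC /b sgn_sq mul1r.
Qed.

End CliffordGroup.

Section AspGroup.
Variable m : nat.
Implicit Types g h : asp m.

Fact asp_one_subproof : asp_pred (pair_one m).
Proof.
apply/asp_predP; split=> [||u v /=]; first exact: group1.
  by apply/unitaryP=> v; rewrite ffunE normr1.
by rewrite !ffunE mulr1.
Qed.

Fact asp_mul_subproof g h : asp_pred (pair_mul (apair g) (apair h)).
Proof.
case: g h => [[T f] /= /asp_predP[/= hT Uf hf]].
case=> [[S k] /= /asp_predP[/= hS Uk hk]].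
apply/asp_predP; split=> [||u v /=]; first exact: groupM.
  apply/unitaryP=> v; rewrite ffunE normrM.
  by rewrite (unitaryP _ Uf) (unitaryP _ Uk) mulr1.
by rewrite !ffunE /= autVD hf hk mulrACA.
Qed.

Fact asp_inv_subproof g : asp_pred (pair_inv (apair g)).
Proof.
case: g => [[T f] /= /asp_predP[/= hT Uf hf]].
apply/asp_predP; split=> [||u v /=]; first by rewrite groupV.
  by apply/unitaryP=> v; rewrite ffunE normfV (unitaryP _ Uf) invr1.
by rewrite !ffunE /= autVD hf invfM.
Qed.

Definition asp_one := Asp asp_one_subproof.
Definition asp_mul g h := Asp (asp_mul_subproof g h).
Definition asp_inv g := Asp (asp_inv_subproof g).

Fact asp_mulA : associative asp_mul.
Proof. by move=> g h k; apply: val_inj; apply: pair_mulA. Qed.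
Fact asp_mul1 : left_id asp_one asp_mul.
Proof. by move=> g; apply: val_inj; apply: pair_mul1. Qed.
Fact asp_mulV : left_inverse asp_one asp_inv asp_mul.
Proof.
move=> g; apply: val_inj; apply: pair_mulV => v.
by case/asp_predP: (apairP g) => _ Uf _; apply: unitary_neq0.
Qed.

HB.instance Definition _ :=
  Finite_isGroup.Build (asp m) asp_mulA asp_mul1 asp_mulV.

Lemma aTM g h : aT (g * h)%g = (aT g * aT h)%g. Proof. by []. Qed.
Lemma achiM g h v : achi (g * h)%g v = achi g (aT h v) * achi h v.
Proof. by rewrite /achi ffunE. Qed.
Lemma aT1 : aT (1%g : asp m) = 1%g. Proof. by []. Qed.
Lemma achi1 v : achi (1%g : asp m) v = 1. Proof. by rewrite /achi ffunE. Qed.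

Lemma asp_ext g h : aT g = aT h -> achi g =1 achi h -> g = h.
Proof.
case: g h => [[T f] gP] [[S k] hP]; rewrite /aT /achi /= => eT ef.
by apply: val_inj; congr pair => //; apply/ffunP.
Qed.

Lemma achiD g u v : achi g (u + v) = achi g u * achi g v.
Proof. by case/asp_predP: (apairP g) => _ _; apply. Qed.

Lemma achi_neq0 g v : achi g v != 0.
Proof. by case/asp_predP: (apairP g) => _ Uf _; apply: unitary_neq0. Qed.

Lemma aT_Sp g : aT g \in Sp m.
Proof. by case/asp_predP: (apairP g). Qed.

Fact asp_lin_subproof (T : autV m) : T \in Sp m -> asp_pred (T, [ffun => 1]).
Proof.
move=> hT; apply/asp_predP; split=> // [|u v /=]; last by rewrite !ffunE mulr1.
by apply/unitaryP=> v; rewrite ffunE normr1.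
Qed.

Fact asp_char_subproof (w : V m) : asp_pred (1%g, [ffun v => sgn (form w v)]).
Proof.
apply/asp_predP; split=> // [||u v /=]; first exact: group1.
  by apply/unitaryP=> v; rewrite ffunE norm_sgn.
by rewrite !ffunE formDr sgnD.
Qed.
Definition asp_char w := Asp (asp_char_subproof w).

End AspGroup.

(* (T, 1) in ASp(A), for (T, lambda) in C_m *)
Definition asp_lin m (g : clifford m) : asp m := Asp (asp_lin_subproof (cT_Sp g)).

Section FunctorF.
Variables (m n : nat) (pi : mx_representation algC [set: asp m] n).

(* Groups act on columns: g . xi = pi g *m xi. *)
Definition weight_space (v : V m) (xi : 'cV[algC]_n) : Prop :=
  forall c : asp m, aT c = 1%g -> pi c *m xi = achi c v *: xi.

(* the projector of U = (+)_v U_v onto U_v *)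
Definition weight_proj (v : V m) : 'M[algC]_n :=
  #|{: V m}|%:R^-1 *: \sum_(c : asp m | aT c == 1%g) (achi c v)^-1 *: pi c.

Definition functorF_mx (g : clifford m) : 'M[algC]_n :=
  \sum_v lam g v *: (pi (asp_lin g) *m weight_proj v).

Lemma piM g h : pi (g * h)%g = pi g *m pi h.
Proof. by rewrite repr_mxM ?inE. Qed.

Lemma weight_projM (c : asp m) v :
  aT c = 1%g -> pi c *m weight_proj v = achi c v *: weight_proj v.
Proof.
move=> c1; rewrite /weight_proj -scalemxAr scalerA mulrC -scalerA; congr (_ *: _).
rewrite mulmx_sumr scaler_sumr [RHS](reindex_inj (mulgI c)) /=.
apply: eq_big => [d|d /eqP d1]; first by rewrite aTM c1 mul1g.
rewrite -scalemxAr -piM scalerA achiM d1 autV1 invfM mulrA mulfV ?mul1r //.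
exact: achi_neq0.
Qed.

Lemma sum_achi (c : asp m) : aT c = 1%g ->
  \sum_v (achi c v)^-1 = if c == 1%g then #|{: V m}|%:R else 0.
Proof.
move=> c1; case: eqP => [->|/eqP nc].
  by rewrite (eq_bigr (fun=> 1)) ?sumr_const // => v _; rewrite achi1 invr1.
have [w nw|all1] := pickP (fun w => achi c w != 1); last first.
  case/eqP: nc; apply: asp_ext => // v; rewrite achi1.
  by apply/eqP/negbFE/all1.
set s := \sum_v _; have: s = (achi c w)^-1 * s.
  rewrite {1}/s (reindex_inj (addrI w)) /= mulr_sumr.
  by apply: eq_bigr => v _; rewrite achiD invfM.
move/eqP; rewrite -subr_eq0 -{1}[s]mul1r -mulrBl mulf_eq0 subr_eq0.
case/orP=> [/eqP e|/eqP //]; case/negP: nw.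
by rewrite -[achi c w]invrK -e invr1.
Qed.

Lemma sum_weight_proj : \sum_v weight_proj v = 1%:M.
Proof.
rewrite /weight_proj -scaler_sumr exchange_big /=.
rewrite (bigD1 1%g) //= [X in _ + X]big1 => [|c /andP[/eqP c1 nc]].
  rewrite addr0 -scaler_suml sum_achi // eqxx scalerA mulVf ?scale1r ?repr_mx1 //.
  by rewrite pnatr_eq0 -lt0n; apply/card_gt0P; exists 0.
by rewrite -scaler_suml sum_achi // (negbTE nc) scale0r.
Qed.

Lemma weight_projE v xi :
  weight_space v xi -> forall w, weight_proj w *m xi = (w == v)%:R *: xi.
Proof.
move=> vxi; have neq w : w != v -> weight_proj w *m xi = 0.
  move=> nwv; have: w - v != 0 by rewrite subr_eq0.
  case/form_nondeg=> z nz; pose c := asp_char z.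
  have c1 : aT c = 1%g by [].
  have nc : achi c w != achi c v.
    apply: contraNneq nz; rewrite /c /achi /= !ffunE => /sgn_inj e.
    have ev0 : v + v = 0 by apply: V_addrr.
    have -> : - v = v by apply: (addrI v); rewrite subrr ev0.
    by rewrite formDr e F2_addrr.
  have comm : weight_proj w *m pi c = achi c w *: weight_proj w.
    rewrite -weight_projM // /weight_proj -scalemxAr -scalemxAl; congr (_ *: _).
    rewrite mulmx_sumr mulmx_suml; apply: eq_bigr => d /eqP d1.
    rewrite -scalemxAr -scalemxAl -!piM; congr (_ *: pi _).
    apply: asp_ext => [|u]; first by rewrite !aTM d1 c1.
    by rewrite !achiM d1 c1 !autV1 mulrC.
  have: achi c w *: (weight_proj w *m xi) = achi c v *: (weight_proj w *m xi).
    by rewrite scalemxAl -comm -mulmxA vxi // -scalemxAr.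
  move/eqP; rewrite -subr_eq0 -scalerBl scaler_eq0 subr_eq0 (negbTE nc).
  by move/eqP.
move=> w; have [->|/neq->] := eqVneq w v; last by rewrite scale0r.
rewrite scale1r -[RHS]mul1mx -sum_weight_proj mulmx_suml (bigD1 v) //=.
by rewrite big1 ?addr0 // => u /neq.
Qed.

Lemma weight_proj_in v xi : weight_space v (weight_proj v *m xi).
Proof. by move=> c c1; rewrite mulmxA weight_projM // scalemxAl. Qed.

(* functorF_mx is characterized by the action on the weight spaces. *)
Lemma functorFE g v xi : weight_space v xi ->
  functorF_mx g *m xi = lam g v *: (pi (asp_lin g) *m xi).
Proof.
move=> vxi; rewrite /functorF_mx mulmx_suml (bigD1 v) //= big1 => [|w nwv].
  by rewrite addr0 -scalemxAl -mulmxA (weight_projE vxi) eqxx scale1r.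
by rewrite -scalemxAl -mulmxA (weight_projE vxi) (negbTE nwv) scale0r mulmx0 scaler0.
Qed.

Lemma weight_space_lin g v xi :
  weight_space v xi -> weight_space (cT g v) (pi (asp_lin g) *m xi).
Proof.
move=> vxi c c1; pose d := ((asp_lin g)^-1 * c * asp_lin g)%g.
have gd : (c * asp_lin g = asp_lin g * d)%g by rewrite /d !mulgA mulgV mul1g.
have d1 : aT d = 1%g by rewrite /d !aTM c1 mulg1 -aTM mulVg.
have -> : achi c (cT g v) = achi d v.
  have := congr1 (fun x => achi x v) gd; rewrite !achiM d1 autV1.
  by rewrite {2 3}/achi /= !ffunE mulr1 mul1r.
by rewrite mulmxA -piM gd piM -mulmxA vxi // scalemxAr.
Qed.

Fact functorF_repr : mx_repr [set: clifford m] functorF_mx.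
Proof.
have ext (M N : 'M[algC]_n) :
    (forall v xi, weight_space v xi -> M *m xi = N *m xi) -> M = N.
  move=> eMN; rewrite -[M]mulmx1 -[N]mulmx1 -sum_weight_proj !mulmx_sumr.
  apply: eq_bigr => v _; apply/matrixP=> i j.
  have e: forall K : 'M[algC]_n, (K *m weight_proj v) i j
            = (K *m (weight_proj v *m delta_mx j 0 : 'cV_n)) i 0.
    by move=> K; rewrite mulmxA -colE [RHS]mxE.
  by rewrite !e (eMN v) //; apply: weight_proj_in.
split=> [|g h _ _]; apply: ext => v xi vxi.
  rewrite (functorFE 1%g vxi) lam1 scale1r mul1mx.
  have -> : asp_lin 1%g = 1%g :> asp m.
    by apply: asp_ext => // u; rewrite achi1 /achi ffunE.
  by rewrite repr_mx1 mul1mx.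
rewrite (functorFE _ vxi) -mulmxA (functorFE h vxi) -scalemxAr.
rewrite (functorFE _ (weight_space_lin h vxi)) mulmxA -piM scalerA mulrC -lamM.
congr (_ *: (pi _ *m _)); apply: asp_ext => // u.
by rewrite achiM /achi /= !ffunE mulr1.
Qed.
Definition functorF := MxRepresentation functorF_repr.

End FunctorF.

Section Induced.
Variables (gT : finGroupType) (H G : {group gT}) (n : nat).
Variable (rH : mx_representation algC H n).

(* C[G] (x)_C[H] U = (+)_i t_i (x) U, over representatives t_i of G / H:
   g t_j (x) u = t_i (x) (t_i^-1 g t_j) u when t_i^-1 g t_j lies in H.         *)
Definition coset_rep (i : 'I_#|lcosets H G|) : gT := repr (enum_val i).

Definition induced_mx (g : gT) : 'M[algC]_(\sum_(i < #|lcosets H G|) n) :=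
  \mxblock_(i < #|lcosets H G|, j < #|lcosets H G|)
    (if ((coset_rep i)^-1 * g * coset_rep j)%g \in H
     then rH ((coset_rep i)^-1 * g * coset_rep j)%g else 0).

Hypothesis sHG : H \subset G.

Lemma coset_repP i : coset_rep i \in G /\ enum_val i = (coset_rep i *: H)%g.
Proof.
rewrite /coset_rep; have /lcosetsP[x Gx ->] := enum_valP i.
have xHr : repr (x *: H)%g \in (x *: H)%g by apply: mem_repr (lcoset_refl H x).
split; last by apply/lcoset_eqP; rewrite lcoset_sym.
by have /lcosetP[y Hy ->] := xHr; rewrite groupM // (subsetP sHG).
Qed.

Lemma coset_rep_eq i j : ((coset_rep i)^-1 * coset_rep j)%g \in H = (i == j).
Proof.
apply/idP/eqP=> [Hij | ->]; last by rewrite mulVg group1.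
apply: enum_val_inj; rewrite (coset_repP i).2 (coset_repP j).2.
by apply/lcoset_eqP; rewrite -mem_lcoset in Hij; rewrite lcoset_sym.
Qed.

Lemma coset_rep_ex x : x \in G -> exists j, ((coset_rep j)^-1 * x)%g \in H.
Proof.
move=> Gx; have xH : (x *: H)%g \in lcosets H G by apply/lcosetsP; exists x.
exists (enum_rank_in xH (x *: H)%g).
rewrite -mem_lcoset -(coset_repP _).2 enum_rankK_in //; exact: lcoset_refl.
Qed.

Fact induced_repr : mx_repr G induced_mx.
Proof.
rewrite /induced_mx; split=> [|g h Gg Gh].
  rewrite -mxdiagZ; apply: eq_mxblock => i j.
  rewrite mulg1 coset_rep_eq; case: eqP => [<-|_].
    by rewrite mulVg repr_mx1 conform_mx_id.
  by [].
rewrite mul_mxblock; apply: eq_mxblock => i k.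
have Gk : (h * coset_rep k)%g \in G by rewrite groupM ?(coset_repP k).1.
have [j Hj] := coset_rep_ex Gk.
have jE l : ((coset_rep l)^-1 * (h * coset_rep k))%g \in H = (l == j).
  rewrite -coset_rep_eq -(groupMr ((coset_rep l)^-1 * coset_rep j)%g Hj).
  by rewrite -!mulgA mulKVg.
have fE : ((coset_rep i)^-1 * (g * h) * coset_rep k
    = (coset_rep i)^-1 * g * coset_rep j
      * ((coset_rep j)^-1 * (h * coset_rep k)))%g.
  by rewrite !mulgA mulgK.
rewrite (bigD1 j) //= big1 ?addr0 => [|l nlj]; last first.
  by rewrite -[(_ * h * _)%g]mulgA jE (negbTE nlj) mulmx0.
rewrite fE groupMr // -[((coset_rep j)^-1 * h * _)%g]mulgA Hj.
by case: ifP => [Hi|_]; rewrite ?mul0mx // repr_mxM.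
Qed.
Definition induced := MxRepresentation induced_repr.

End Induced.

Section Block.
Variable m : nat.

(* P_m |x \hat V_m as a subgroup of ASp(A) *)
Definition PV_set : {set asp m} := [set g | aT g \in P m].

Lemma in_PV g : (g \in PV_set) = (aT g \in P m).
Proof. by rewrite [LHS]inE. Qed.

Fact PV_group_set : group_set PV_set.
Proof.
apply/group_setP; split=> [|g h]; first by rewrite in_PV aT1 group1.
by rewrite !in_PV => hg hh; rewrite aTM groupM.
Qed.
Canonical PV := Group PV_group_set.

Section Inflate.
Variables (n : nat) (tau : mx_representation algC (P m) n).

Definition inflate_mx (g : asp m) : 'M[algC]_n := achi g (uvec m) *: tau (aT g).

Fact inflate_repr : mx_repr PV inflate_mx.
Proof.
rewrite /inflate_mx; split=> [|g h].
  by rewrite achi1 scale1r aT1 repr_mx1.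
rewrite !in_PV => hg hh; rewrite aTM repr_mxM // achiM.
have /setIdP[_ /eqP->] := hh.
by rewrite -scalemxAl -scalemxAr scalerA.
Qed.
Definition inflate := MxRepresentation inflate_repr.

(* Pi(u_m, tau) *)
Definition Pi_nz := induced inflate (subsetT PV).

End Inflate.

Definition chi_nz (t : Iirr (P m)) : 'CF([set: clifford m]) :=
  cfRepr (functorF (Pi_nz 'Chi_t)).

Fact K_subproof (v : V m) : clifford_pred (1%g, [ffun x => sgn (form v x)]).
Proof.
apply/clifford_predP; split=> [|x y /=].
  by apply/unitaryP=> x; rewrite ffunE norm_sgn.
by rewrite !ffunE !autV1 /beta sgn_sq mul1r formDr sgnD.
Qed.
Definition K v := Clifford (K_subproof v).

Lemma cTK v : cT (K v) = 1%g. Proof. by []. Qed.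
Lemma lamK v x : lam (K v) x = sgn (form v x).
Proof. by rewrite /lam ffunE. Qed.

Lemma formBl (u v w : V m) : form (u + v) w = form u w + form v w.
Proof. by rewrite formC formDr !(formC w). Qed.

Lemma K_inj : injective K.
Proof.
move=> v w eK; apply/eqP; rewrite -subr_eq0; apply/negPn/negP.
case/form_nondeg=> z /negP[]; apply/eqP.
have -> : - w = w by apply: (addrI w); rewrite subrr V_addrr.
rewrite formDr !(formC z); apply: sgn_inj; rewrite sgnD -!lamK eK lamK.
exact: sgn_sq.
Qed.

Lemma KD v w : K (v + w) = (K v * K w)%g.
Proof.
apply: clifford_ext => [|x]; first by rewrite cTM !cTK mulg1.
by rewrite lamM !lamK cTK autV1 formBl sgnD.
Qed.

Lemma K0 : K 0 = 1%g.
Proof. by apply: (mulgI (K 0)); rewrite -KD addr0 mulg1. Qed.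

Definition KV_set : {set clifford m} := [set K v | v : V m].

Fact KV_group_set : group_set KV_set.
Proof.
apply/group_setP; split; first by apply/imsetP; exists 0; rewrite ?K0.
by move=> _ _ /imsetP[v _ ->] /imsetP[w _ ->]; rewrite -KD; apply: imset_f.
Qed.
Canonical KV := Group KV_group_set.

Lemma K_conj v g : (K v ^ g)%g = K ((cT g)^-1%g v).
Proof.
apply: (mulgI g); rewrite conjgE mulKVg.
apply: clifford_ext => [|x]; first by rewrite !cTM !cTK mulg1 mul1g.
rewrite !lamM !lamK cTK autV1 mulrC; congr (_ * sgn _).
by have /SpP h := cT_Sp g; rewrite -[RHS]h autVKV.
Qed.

Lemma KV_normal : KV <| [set: clifford m].
Proof.
rewrite /normal subsetT; apply/subsetP=> g _; rewrite inE.
apply/subsetP=> _ /imsetP[_ /imsetP[v _ ->] ->].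
by rewrite K_conj; apply: imset_f.
Qed.

Definition Kinv (g : clifford m) : V m := odflt 0 [pick v | K v == g].

Lemma KK : cancel K Kinv.
Proof.
move=> v; rewrite /Kinv; case: pickP => [w /eqP/K_inj //|/(_ v)].
by rewrite eqxx.
Qed.

(* chi_v(x) = (-1)^<v,x>, as a function on the image of V_m in C_m *)
Fact chiV_subproof (v : V m) :
  is_class_fun <<KV>> [ffun g => if g \in KV then sgn (form v (Kinv g)) else 0].
Proof.
rewrite genGid; apply: intro_class_fun => [g h|g /negbTE-> //].
move=> /imsetP[x _ ->] /imsetP[y _ ->].
by rewrite K_conj cTK invg1 autV1.
Qed.
Definition chiV v : 'CF(KV) := Cfun 0 (chiV_subproof v).

Lemma chiVE v x : chiV v (K x) = sgn (form v x).
Proof. by rewrite cfunE imset_f // KK. Qed.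

(* The irreducible characters of C_m whose restriction to V_m involves the orbit
   of chi_{u_m}.                                                               *)
Definition block_nz : pred 'CF([set: clifford m]) := fun phi =>
  (phi \in irr [set: clifford m]) &&
  has (fun xi => '['Res[KV] phi, xi] != 0) (chiV (uvec m) ^: [set: clifford m])%CF.

Definition inertia_nz : {group clifford m} := 'I_[set: clifford m][chiV (uvec m)]%G.

(* F_T, and the restriction of lambda_g to it *)
Definition fixed_space (T : autV m) := {x : V m | T x == x}.

Definition ell (g : clifford m) : fixed_space (cT g) -> algC :=
  fun x => lam g (val x).

End Block.

(* Main.v *)
Require Import Defs.
From HB Require Import structures.
From mathcomp Require Import all_boot all_order all_fingroup all_algebra.
From mathcomp Require Import all_solvable all_field all_character.
From mathcomp Require Import ring.

(** The theorem is Clifford theory for the normal subgroup [KV] (a copy of V_m)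
    of the Clifford group, in the favourable case where the linear character
    chi_u, u = u_m, extends to its inertia group.

    Conjugation by g = (T, lambda) permutes the characters chi_v as the symplectic
    map T permutes the vectors v, so the inertia group I of chi_u consists of the
    g with T in P_m ([in_inertia]).  The extension of chi_u to I is explicit: it is
    g |-> lambda_g(u).  Indeed lambda_(gh)(u) = lambda_g(T_h u) lambda_h(u), and
    T_h u = u when h lies in I, so that this function is multiplicative on I; and
    on K_v it takes the value (-1)^<v,u> = chi_u(v).  This is why no factor set
    appears.  Gallagher's theorem and the Clifford correspondence
    ([irr_over_extendible]) then list the block, without repetition, as the
    characters Ind_I^C (b * lambda(u)) for b an irreducible character of I / V_m.

    Two facts on the groups identify I / V_m with P_m and locate the orbit of u.
    Every symplectic T lifts to the Clifford group ([clifford_lift]): the sign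
    cocycle beta(Tx,Ty) beta(x,y) is symmetric and bilinear, and a symmetric
    bilinear form over F_2 is the coboundary of a function with values in the
    fourth roots of unity.  And Sp(V_m) is transitive on nonzero vectors, by
    transvections ([Sp_trans]).

    It remains to compare Ind_I^C (tau * lambda(u)) with the character of
    F(Pi(u, tau)).  Both ASp(A) and C_m act on V_m through Sp(V_m), both inductions
    start from the stabilizer of u, and the second components of pairs multiply by
    the same rule in both groups.  So one computation
    ([cfInd_columns]) evaluates both induced characters as a sum over the nonzero
    fixed points of T.  The functor F replaces chi(x) by lambda_g(x) at each fixed
    point x: its trace formula ([functorF_char]) is a Fourier transform over the
    characters of V_m, and orthogonality ([sum_achi_dual]) selects the weight x. *)

Set Implicit Arguments.
Unset Strict Implicit.
Unset Printing Implicit Defensive.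

Import GroupScope Order.TTheory GRing.Theory Num.Theory.
Local Open Scope ring_scope.

Local Notation form := Defs.form.
Local Notation formC := Defs.formC.
Local Notation formDr := Defs.formDr.
Local Notation form0r := Defs.form0r.

(** * Symmetric sign cocycles over F_2, and lifting Sp(V_m) to the Clifford group *)

Definition biadditive (U : zmodType) (b : U -> U -> 'F_2) :=
  (forall u, {morph b u : v w / v + w}) /\ (forall v, {morph b^~ v : u w / u + w}).

Lemma additive_rowE n (f : 'rV['F_2]_n -> 'F_2) :
  {morph f : r s / r + s} -> forall r, f r = \sum_j r 0 j * f (delta_mx 0 j).
Proof.
move=> fD r; have f0 : f 0 = 0 by apply: (addrI (f 0)); rewrite -fD !addr0.
rewrite {1}[r]row_sum_delta (big_morph f fD f0); apply: eq_bigr => j _.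
case: (r 0 j) => [[|[|[]]]] // ic.
  by rewrite (_ : Ordinal ic = 0) ?scale0r ?mul0r //; apply: val_inj.
by rewrite (_ : Ordinal ic = 1) ?scale1r ?mul1r //; apply: val_inj.
Qed.

Lemma biadditive_mxE n (b : 'rV['F_2]_n -> 'rV['F_2]_n -> 'F_2) :
  biadditive b -> forall r s,
  b r s = (r *m (\matrix_(i, j) b (delta_mx 0 i) (delta_mx 0 j)) *m s^T) 0 0.
Proof.
case=> bDr bDl r s; rewrite mxE (additive_rowE (bDr r)); apply: eq_bigr => j _.
rewrite mulrC [s^T _ _]mxE; congr (_ * _).
by rewrite mxE (additive_rowE (bDl _)); apply: eq_bigr => i _; rewrite mxE.
Qed.

(** The upper triangular half U of the alternating Gram matrix M satisfies
    M = U + U^T, and r |-> r U r^T is the required quadratic form. *)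
Lemma alternating_polar n (b : 'rV['F_2]_n -> 'rV['F_2]_n -> 'F_2) :
    biadditive b -> (forall r, b r r = 0) ->
  exists Q : 'rV['F_2]_n -> 'F_2, forall r s, Q (r + s) = Q r + Q s + b r s.
Proof.
move=> bB b0; have bE := biadditive_mxE bB; case: bB => bDr bDl.
have bC r s : b r s = b s r.
  have := b0 (r + s); rewrite bDr !bDl !b0 add0r addr0 => e.
  by apply: (addrI (b s r)); rewrite e F2_addrr.
set M := \matrix_(i, j) b (delta_mx 0 i) (delta_mx 0 j) in bE.
pose U := \matrix_(i < n, j < n) if (i < j)%N then M i j else 0.
have MU : M = U + U^T.
  apply/matrixP=> i j; rewrite !mxE; case: ltngtP => [||/val_inj <-].
  - by rewrite addr0.
  - by rewrite add0r bC.
  - by rewrite b0 addr0.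
exists (fun r => (r *m U *m r^T) 0 0) => r s.
rewrite bE MU mulmxDr mulmxDl linearD /= mulmxDl !mulmxDr !mulmxDl.
have -> : r *m U^T *m s^T = (s *m U *m r^T)^T by rewrite !trmx_mul trmxK mulmxA.
by rewrite !mxE; ring.
Qed.

(** Lifting F_2 to {0, 1} and taking powers of i turns addition mod 2 into
    multiplication up to a sign, because i^2 = -1 corrects the carry. *)
Lemma expiD (c d : 'F_2) : 'i ^+ (c + d)%R = sgn (c * d) * ('i ^+ c * 'i ^+ d) :> algC.
Proof.
case: c d => [[|[|[]]]] // ic [[|[|[]]]] // id; rewrite /sgn /=;
  rewrite ?expr0 ?expr1 ?mulr1 ?mul1r //.
by rewrite -expr2 sqrCi mulrNN mulr1.
Qed.

(** Over F_2 the diagonal d(r) = b(r,r) of a symmetric form is linear, so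
    b(r,s) + d(r) d(s) is alternating, hence polar to a quadratic form Q; the
    product d(r) d(s) is the cocycle of i^d.  Thus l = i^d (-1)^Q. *)
Lemma sign_cocycle_trivial n (b : 'rV['F_2]_n -> 'rV['F_2]_n -> 'F_2) :
    biadditive b -> (forall r s, b r s = b s r) ->
  exists2 l : 'rV['F_2]_n -> algC, (forall r, `|l r| = 1)
    & forall r s, l (r + s) = sgn (b r s) * (l r * l s).
Proof.
move=> [bDr bDl] bC; pose d r := b r r.
have dD r s : d (r + s) = d r + d s.
  by rewrite /d bDr !bDl (bC s r) -addrA (addrA (b r s)) F2_addrr add0r.
have [|r|Q QD] := @alternating_polar n (fun r s => b r s + d r * d s).
- split=> [u v w|v u w]; rewrite dD ?bDr ?bDl; ring.
- by rewrite /d; case: (b r r) => [[|[|[]]]] // ic; apply: val_inj.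
exists (fun r => 'i ^+ d r * sgn (Q r)) => [r|r s].
  by rewrite normrM norm_sgn normrX normCi expr1n mulr1.
rewrite dD QD expiD !sgnD.
rewrite -[RHS]mulr1 -(sgn_sq (d r * d s)); ring.
Qed.

Lemma F2_exchange (a b c d : 'F_2) : a + b = c + d -> a + c = b + d.
Proof.
move=> e; have -> : a + c = a + b + (c + b) - (b + b) by ring.
rewrite e; have -> : c + d + (c + b) - (b + b) = c + c + (b + d) - (b + b) by ring.
by rewrite !F2_addrr add0r subr0.
Qed.

(** Surjectivity of C_m -> Sp(V_m).  That T is symplectic says exactly that the
    bilinear cocycle of the pair condition is symmetric. *)
Lemma clifford_lift m (T : autV m) : T \in Sp m -> exists g : clifford m, cT g = T.
Proof.
move=> /SpP TSp; pose vec (r : 'rV['F_2]_(m + m)) : V m := (lsubmx r, (rsubmx r)^T).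
pose row (v : V m) : 'rV['F_2]_(m + m) := row_mx v.1 v.2^T.
have rowK : cancel row vec.
  by case=> a xi; rewrite /vec /row row_mxKl row_mxKr trmxK.
have vecD r s : vec (r + s) = vec r + vec s.
  by rewrite /vec !linearD.
have rowD u v : row (u + v) = row u + row v.
  by rewrite /row add_row_mx -[(_ + _^T)]linearD.
pose c (u v : V m) := ev (T u).2 (T v).1 + ev u.2 v.1.
have [||l Ul lD] := @sign_cocycle_trivial _ (fun r s => c (vec r) (vec s)).
- split=> [u v w|v u w]; rewrite /c vecD autVD /= ?evDr ?evDl; ring.
- move=> r s; have := TSp (vec r) (vec s); rewrite /form /c.
  by move/F2_exchange.
have lP : clifford_pred (T, [ffun v => l (row v)]).
  apply/clifford_predP; split=> [|u v]; first by apply/unitaryP=> v; rewrite ffunE.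
  by rewrite !ffunE rowD lD !rowK sgnD /beta.
by exists (Clifford lP).
Qed.

(** * Transitivity of Sp(V_m) on nonzero vectors *)

Lemma form_alt m (v : V m) : form v v = 0.
Proof. by rewrite /form F2_addrr. Qed.

Lemma F2_eq01 (c : 'F_2) : c = 0 \/ c = 1.
Proof. by case: c => [[|[|[]]]] // ic; [left | right]; apply: val_inj. Qed.

(** The transvection along a is an involution because <a,a> = 0, and an isometry
    because the two cross terms also cancel mod 2. *)
Lemma transvection_ex m (a : V m) :
  exists2 T, T \in Sp m & forall v, T v = v + a *+ form v a.
Proof.
pose f v := v + a *+ form v a.
have scaleD (c d : 'F_2) : a *+ (c + d)%R = a *+ c + a *+ d.
  case: (F2_eq01 c) (F2_eq01 d) => -> [] -> /=; rewrite ?mulr0n ?addr0 ?add0r //.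
  by rewrite V_addrr.
have fD u v : f (u + v) = f u + f v by rewrite /f formBl scaleD addrACA.
have formM u v (c : 'F_2) : form u (v *+ c) = form u v * c.
  by case: (F2_eq01 c) => ->; rewrite ?mulr0n ?form0r ?mulr0 ?mulr1.
have fa v : form (f v) a = form v a.
  by rewrite /f formBl (formC (a *+ _)) formM form_alt mul0r addr0.
have fK : involutive f.
  by move=> v; rewrite {1}/f fa /f -addrA V_addrr addr0.
have ff u v : form (f u) (f v) = form u v.
  rewrite {2}/f formDr formM fa {1}/f formBl (formC (a *+ _)) formM (formC v a).
  by rewrite (mulrC (form a v)) -addrA F2_addrr addr0.
pose s := perm (can_inj fK).
have sP : additive_perm s.
  by apply/forallP=> u; apply/forallP=> v; rewrite !permE fD.
exists (AutV sP) => [|v]; last by rewrite /autV_fun /= permE.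
by apply/SpP=> u v; rewrite /autV_fun /= !permE.
Qed.

(** If <x,y> = 1 the transvection along x + y takes x to y.  In general two such
    steps go through a vector w with <u,w> = <w,v> = 1. *)
Lemma Sp_trans m (u v : V m) : u != 0 -> v != 0 ->
  exists2 T, T \in Sp m & T u = v.
Proof.
have step (x y : V m) : form x y = 1 -> exists2 T, T \in Sp m & T x = y.
  move=> xy; have [T TSp TE] := transvection_ex (x + y).
  by exists T => //; rewrite TE formDr form_alt xy add0r addrA V_addrr add0r.
have ne0 (c : 'F_2) : c != 0 -> c = 1 by case: (F2_eq01 c) => -> //; rewrite eqxx.
move=> nu nv; have [a /ne0 au] := form_nondeg nu; have [b /ne0 bv] := form_nondeg nv.
have [w uw wv] : exists2 w, form u w = 1 & form w v = 1.
  case: (F2_eq01 (form a v)) => av; last by exists a; rewrite ?(formC u).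
  case: (F2_eq01 (form b u)) => bu; last by exists b; rewrite ?(formC u).
  by exists (a + b); rewrite ?(formC u) formBl ?au ?bu ?av ?bv ?addr0 ?add0r.
have [T TSp Tu] := step _ _ uw; have [S SSp Sw] := step _ _ wv.
by exists (S * T)%g; rewrite ?groupM // autVM Tu.
Qed.

(** * Induced characters *)

(** When the cosets of H are the fibres of a map p, an induced character is a sum
    over any section of p: the terms of the usual average over G are constant
    along each fibre. *)
Lemma cfInd_section (gT : finGroupType) (G H : {group gT}) (X : finType)
    (D : {set X}) (p : gT -> X) (s : X -> gT) (phi : 'CF(H)) (g : gT) :
    H \subset G -> {in G, forall y, p y \in D} ->
    {in G &, forall y z, (p y == p z) = (y^-1 * z \in H)%g} ->
    {in D, forall x, s x \in G /\ p (s x) = x} ->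
  'Ind[G] phi g = \sum_(x in D) phi (g ^ s x)%g.
Proof.
move=> sHG pD pE sP; rewrite cfIndE // (partition_big p (mem D)) //= mulr_sumr.
apply: eq_bigr => x Dx; have [Gs ps] := sP x Dx.
have fib y : (y \in G) && (p y == x) = (y \in s x *: H)%g.
  rewrite mem_lcoset; case Gy: (y \in G) => /=; last first.
    by apply/esym; apply: contraFF Gy => /(subsetP sHG); rewrite groupMl // groupV.
  by rewrite eq_sym -{1}ps pE.
rewrite (eq_bigr (fun=> phi (g ^ s x)%g)) => [|y]; last first.
  by rewrite fib => /lcosetP[h Hh ->]; rewrite conjgM cfunJ.
rewrite (eq_bigl _ _ fib) sumr_const card_lcoset -[RHS]mul1r mulrC.
by rewrite -[_ *+ _]mulr_natr -mulrA divff ?mulr1 ?mul1r // neq0CG.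
Qed.

Lemma cfRepr_induced (gT : finGroupType) (G H : {group gT}) n
    (rH : mx_representation algC H n) (sHG : H \subset G) :
  cfRepr (induced rH sHG) = 'Ind[G] (cfRepr rH).
Proof.
apply/cfun_inP=> g Gg; rewrite cfunE Gg mulr1n /= /induced_mx mxtrace_mxblock.
rewrite (@cfInd_section _ G H _ (lcosets H G) (fun y => y *: H)%g repr) //.
- rewrite [RHS]big_enum_val; apply: eq_bigr => i _; rewrite /conjg mulgA cfunE.
  by rewrite -/(coset_rep i); case: ifP => _; rewrite ?mulr1n ?mxtrace0.
- by move=> y Gy; apply/lcosetsP; exists y.
- move=> y z _ _; rewrite -mem_lcoset lcoset_sym; apply/eqP/idP=> [<- | /lcoset_eqP //].
  exact: lcoset_refl.
- move=> A /lcosetsP[x Gx ->]; have := mem_repr x (lcoset_refl H x).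
  move=> xHr; split; last exact/lcoset_eqP.
  by case/lcosetP: xHr => h /(subsetP sHG) Gh ->; rewrite groupM.
Qed.

(** * The trace of the functor F *)

Lemma achi_at0 m (c : asp m) : achi c 0 = 1.
Proof. by apply: (mulfI (achi_neq0 c 0)); rewrite mulr1 -achiD addr0. Qed.

(** Orthogonality of the characters of V_m in the variable dual to that of
    [sum_achi].  Summing over both variables and using [sum_achi] gives the value
    at v = 0, which is the number of characters. *)
Lemma sum_achi_dual m (v : V m) :
  \sum_(c : asp m | aT c == 1%g) achi c v = if v == 0 then #|{: V m}|%:R else 0.
Proof.
have off w : w != 0 -> \sum_(c : asp m | aT c == 1%g) achi c w = 0.
  case/form_nondeg=> z nz; set s := \sum_(c | _) _.
  have : s = sgn (form z w) * s.
    rewrite {1}/s (reindex_inj (mulgI (asp_char z))) /= mulr_sumr.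
    apply: eq_big => [c|c]; first by rewrite aTM mul1g.
    by rewrite aTM mul1g => /eqP c1; rewrite achiM c1 autV1 {1}/achi /= ffunE.
  move/eqP; rewrite -subr_eq0 -{1}[s]mul1r -mulrBl mulf_eq0 subr_eq0.
  case/orP=> [/eqP e|/eqP //]; case/negP: nz; apply/eqP/sgn_inj.
  by rewrite -e sgn0.
case: eqP => [->|/eqP/off//].
have <- : \sum_(c : asp m | aT c == 1%g) \sum_w achi c w = #|{: V m}|%:R.
  have rowE (c : asp m) : aT c == 1%g ->
      \sum_w achi c w = if c == 1%g then #|{: V m}|%:R else 0.
    move=> /eqP c1; have cV1 : aT c^-1%g = 1%g by rewrite -[aT c^-1%g]mulg1 -c1 -aTM mulVg c1.
    rewrite -[c == _](inj_eq invg_inj) invg1 -(sum_achi cV1).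
    apply: eq_bigr => w _; apply: (mulfI (achi_neq0 c^-1%g w)).
    by rewrite mulfV ?achi_neq0 // -{1}[w]autV1 -c1 -achiM mulVg achi1.
  rewrite (eq_bigr _ rowE) (bigD1 1%g) ?eqxx //= big1 ?addr0 // => c /andP[_].
  by move/negbTE->.
by rewrite exchange_big (bigD1 0) //= [X in _ = _ + X]big1 ?addr0.
Qed.

(** The projector onto U_v is an average of [pi c] over the characters c, each of
    which takes only the values 1 and -1 and so equals its inverse. *)
Lemma functorF_char m n (pi : mx_representation algC [set: asp m] n) g :
  cfRepr (functorF pi) g =
  #|{: V m}|%:R^-1 * \sum_v lam g v *
    \sum_(c : asp m | aT c == 1%g) achi c v * cfRepr pi (asp_lin g * c)%g.
Proof.
rewrite cfunE inE mulr1n /= /functorF_mx raddf_sum mulr_sumr /=.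
apply: eq_bigr => v _; rewrite linearZ /= mulrCA; congr (_ * _).
rewrite /weight_proj -scalemxAr linearZ /=; congr (_ * _).
rewrite mulmx_sumr raddf_sum; apply: eq_bigr => c /eqP c1 /=.
rewrite -scalemxAr linearZ /= -piM cfunE inE mulr1n; congr (_ * _).
have cc : (c * c = 1)%g.
  apply: asp_ext => [|u]; first by rewrite aTM c1 mulg1.
  by rewrite achiM c1 autV1 -achiD V_addrr achi_at0 achi1.
apply: (mulfI (achi_neq0 c v)); rewrite mulfV ?achi_neq0 //.
by rewrite -{1}[v]autV1 -c1 -achiM cc achi1.
Qed.

(** * Characters as sums over nonzero fixed points *)

Lemma in_P m (T : autV m) : (T \in P m) = (T \in Sp m) && (T (uvec m) == uvec m).
Proof. exact: in_set. Qed.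

Lemma in_P_div m (S T : autV m) : S \in Sp m -> T \in Sp m ->
  (S^-1 * T \in P m)%g = (S (uvec m) == T (uvec m)).
Proof.
move=> hS hT; rewrite in_P groupM ?groupV // autVM.
by rewrite -(inj_eq (can_inj (autVK S))) autVKV eq_sym.
Qed.

Lemma uvec_neq0 m : (0 < m)%N -> uvec m != 0.
Proof.
case: m => // m _; apply/eqP=> /(congr1 fst)/matrixP/(_ 0 0)/eqP.
by rewrite !mxE.
Qed.

Lemma in_P_conj m (S T : autV m) : S \in Sp m -> T \in Sp m ->
  (T ^ S \in P m)%g = (T (S (uvec m)) == S (uvec m)).
Proof.
by move=> hS hT; rewrite conjgE in_P_div ?groupM // autVM eq_sym.
Qed.

(** At a fixed point the scalars contributed by h and its inverse cancel, so
    conjugation only moves the point. *)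
Lemma achiJ m (g h : asp m) v : aT g (aT h v) = aT h v ->
  achi (g ^ h)%g v = achi g (aT h v).
Proof.
move=> fx; rewrite conjgE !achiM aTM autVM fx mulrCA -achiM mulVg.
by rewrite achi1 mulr1.
Qed.

Lemma lamJ m (g h : clifford m) v : cT g (cT h v) = cT h v ->
  lam (g ^ h)%g v = lam g (cT h v).
Proof.
move=> fx; rewrite conjgE !lamM cTM autVM fx mulrCA -lamM mulVg.
by rewrite lam1 mulr1.
Qed.

Lemma cfRepr_inflate m (t : Iirr (P m)) (g : asp m) :
  cfRepr (inflate 'Chi_t) g = achi g (uvec m) * 'chi_t (aT g).
Proof.
rewrite -irrRepr !cfunE /= /inflate_mx linearZ /= in_PV.
by case: (aT g \in P m); rewrite ?mulr1n ?mulr0n ?mulr0.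
Qed.

Section Columns.
Variables (m : nat) (Tx : V m -> autV m).
Hypothesis m_gt0 : (0 < m)%N.
Hypothesis TxP : forall x, x != 0 -> Tx x \in Sp m /\ Tx x (uvec m) = x.

Lemma Sp_uvec_neq0 (T : autV m) : T (uvec m) != 0.
Proof.
by rewrite -(inj_eq (can_inj (autVKV T))) autV0 autVK uvec_neq0.
Qed.

(** The common computation for ASp(A) and C_m: q is the projection onto Sp(V_m),
    w the scalar component of a pair.  The coset space of H is the orbit of u_m,
    that is, all nonzero vectors; the coset of x contributes only when x is fixed,
    as otherwise the conjugate leaves P_m and [tau] vanishes there. *)
Lemma cfInd_columns (gT : finGroupType) (H : {group gT}) (q : gT -> autV m)
    (w : gT -> V m -> algC) (phi : 'CF(H)) (tau : 'CF(P m)) g :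
    {morph q : h k / (h * k)%g} -> (forall h, q h \in Sp m) ->
    (forall T, T \in Sp m -> exists h, q h = T) ->
    (forall h, (h \in H) = (q h \in P m)) ->
    (forall h, phi h = w h (uvec m) * tau (q h)) ->
    (forall h k v, q h (q k v) = q k v -> w (h ^ k)%g v = w h (q k v)) ->
  'Ind[[set: gT]] phi g =
    \sum_(x | (x != 0) && (q g x == x)) w g x * tau ((Tx x)^-1 * q g * Tx x)%g.
Proof.
move=> qM qSp qlift inH phiE wJ.
have q1 : q 1%g = 1%g by apply: (mulgI (q 1%g)); rewrite -qM !mulg1.
have qV h : q h^-1%g = (q h)^-1%g by apply: (mulgI (q h)); rewrite -qM !mulgV.
pose s x := odflt 1%g [pick h | q h == Tx x].
have sE x : x != 0 -> q (s x) = Tx x.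
  move=> /TxP[/qlift[h hx] _]; rewrite /s; case: pickP => [k /eqP // | /(_ h)].
  by rewrite hx eqxx.
rewrite (@cfInd_section _ _ _ _ [set~ 0] (fun h => q h (uvec m)) s) ?subsetT //.
- rewrite [RHS]big_mkcondr; apply: eq_big => [x|x]; rewrite !inE // => nx.
  have [TxSp Txu] := TxP nx.
  have -> : phi (g ^ s x)%g = w (g ^ s x)%g (uvec m) * tau ((Tx x)^-1 * q g * Tx x)%g.
    by rewrite phiE [q _](congr1 q (conjgE _ _)) !qM qV sE // mulgA.
  case: eqP => [fx | nfx]; first by rewrite wJ sE ?Txu.
  rewrite [tau _]cfun0 ?mulr0 // -mulgA -conjgE in_P_conj // Txu.
  exact/eqP.
- by move=> h _; rewrite !inE Sp_uvec_neq0.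
- by move=> h k _ _; rewrite inH qM qV in_P_div.
- by move=> x; rewrite !inE => nx; have [_ Txu] := TxP nx; rewrite sE.
Qed.

(** The character of Pi(u_m, tau) at (T, chi) is a sum of chi(x) over fixed x.
    In the trace of F it is paired with each weight v, and averaging over chi
    keeps only v = x, leaving the factor lambda_g(x). *)
Lemma chi_nz_columns (t : Iirr (P m)) (g : clifford m) :
  chi_nz t g = \sum_(x | (x != 0) && (cT g x == x))
    lam g x * 'chi_t ((Tx x)^-1 * cT g * Tx x)%g.
Proof.
have asp_col (c : asp m) : cfRepr (Pi_nz 'Chi_t) c =
    \sum_(x | (x != 0) && (aT c x == x)) achi c x * 'chi_t ((Tx x)^-1 * aT c * Tx x)%g.
  rewrite cfRepr_induced.
  apply: (cfInd_columns c (@aTM m) (@aT_Sp m) _ _ (cfRepr_inflate t) (@achiJ m)).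
    by move=> T TSp; exists (Asp (asp_lin_subproof TSp)).
  exact: in_PV.
rewrite /chi_nz functorF_char.
have lin1 x : achi (asp_lin g) x = 1 by rewrite /achi ffunE.
pose F x := 'chi_t ((Tx x)^-1 * cT g * Tx x)%g.
have inner v : \sum_(c : asp m | aT c == 1%g)
      achi c v * cfRepr (Pi_nz 'Chi_t) (asp_lin g * c)%g
    = #|{: V m}|%:R * (if (v != 0) && (cT g v == v) then F v else 0).
  transitivity (\sum_(x | (x != 0) && (cT g x == x))
      F x * \sum_(c : asp m | aT c == 1%g) achi c (v + x)).
    under [RHS]eq_bigr do rewrite mulr_sumr.
    rewrite [RHS]exchange_big; apply: eq_bigr => c /eqP c1; rewrite asp_col mulr_sumr.
    have aTgc : aT (asp_lin g * c)%g = cT g by rewrite aTM c1 mulg1.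
    rewrite aTgc; apply: eq_bigr => x _.
    rewrite achiM c1 autV1 lin1 mul1r mulrA -achiD; exact: mulrC.
  rewrite mulrC; case: ifP => [vP | vnP].
    (* Only x = v survives, since v + x = 0 means x = v in characteristic 2. *)
    rewrite (bigD1 v) //= sum_achi_dual V_addrr eqxx big1 ?addr0 // => x /andP[_ nxv].
    rewrite sum_achi_dual; case: eqP => [e | _]; last by rewrite mulr0.
    by case/eqP: nxv; rewrite -[x]add0r -(V_addrr v) -addrA e addr0.
  rewrite mul0r big1 // => x xP; rewrite sum_achi_dual.
  case: eqP => [e | _]; last by rewrite mulr0.
  have xv : x = v by rewrite -[x]add0r -(V_addrr v) -addrA e addr0.
  by rewrite -xv xP in vnP.
rewrite (eq_bigr _ (fun v _ => congr1 _ (inner v))).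
under eq_bigr do rewrite mulrCA; rewrite -mulr_sumr mulKf; last first.
  by rewrite pnatr_eq0 -lt0n; apply/card_gt0P; exists 0.
by rewrite [RHS]big_mkcond; apply: eq_bigr => v _; rewrite (fun_if ( *%R _)) mulr0.
Qed.

End Columns.

(** * Irreducible characters over an extendible character *)

(** Gallagher's theorem describes the irreducible characters of the inertia group
    over theta, and induction carries them bijectively to those of G. *)
Lemma irr_over_extendible (gT : finGroupType) (G N : {group gT}) (theta : 'CF(N))
    (psi : 'CF('I_G[theta])) :
    N <| G -> theta \in irr N -> psi \in irr 'I_G[theta] -> 'Res[N] psi = theta ->
  injective (fun b : Iirr ('I_G[theta] / N) => 'Ind[G] (('chi_b %% N)%CF * psi))
  /\ forall phi : 'CF(G), (phi \in irr G) && ('['Res[N] phi, theta] != 0) <->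
       exists b : Iirr ('I_G[theta] / N), phi = 'Ind[G] (('chi_b %% N)%CF * psi).
Proof.
move=> nNG /irrP[t Dt]; move: theta Dt psi => _ -> _ /irrP[c ->] ext.
set T := 'I_G['chi_t]%G; pose Phi (b : Iirr (T / N)) := 'Ind[G] (('chi_b %% N)%CF * 'chi_c).
have nNT : N <| T := normal_Inertia 'chi_t (normal_sub nNG).
have [irr_mul mul_inj calA _] := constt_Ind_ext nNT ext.
have [Aext Ainj AtoB _ _] := constt_Inertia_bijection t nNG.
have memA (b : Iirr (T / N)) : mul_mod_Iirr c b \in irr_constt ('Ind[T] 'chi_t).
  by rewrite calA codom_f.
have PhiE b : Phi b = 'chi_(Ind_Iirr G (mul_mod_Iirr c b)).
  rewrite cfIirrE ?Aext //; congr ('Ind[G] _).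
  by rewrite cfIirrE // mod_IirrE.
split=> [b b' | phi].
  by rewrite -/(Phi b) -/(Phi b') !PhiE => /irr_inj/Ainj-/(_ (memA _) (memA _))/mul_inj.
split=> [/andP[/irrP[k ->] ] | [b ->]].
  rewrite -irr_consttE -constt_Ind_Res -AtoB => /imsetP[s].
  by rewrite calA => /codomP[b ->] ->; exists b; rewrite -/(Phi b) PhiE.
rewrite -/(Phi b) PhiE mem_irr /= -irr_consttE -constt_Ind_Res -AtoB.
by apply: imset_f.
Qed.

(** * The inertia group of chi_u and the extension of chi_u *)

Lemma asp_char_inj m : injective (@asp_char m).
Proof.
move=> v w e; apply/(@K_inj m)/clifford_ext => // x.
by rewrite !lamK; have := congr1 (fun c => achi c x) e; rewrite /achi /= !ffunE.
Qed.

(** By counting: [sum_achi_dual] at 0 says that V_m has as many characters as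
    elements. *)
Lemma asp_char_onto m (c : asp m) : aT c = 1%g -> exists v, c = asp_char v.
Proof.
move=> c1; have : c \in [set asp_char v | v : V m].
  have/eqP-> : [set asp_char v | v : V m] == [set d : asp m | aT d == 1%g].
    rewrite eqEcard; apply/andP; split.
      by apply/subsetP=> _ /imsetP[v _ ->]; rewrite inE.
    rewrite card_imset; last exact: asp_char_inj.
    have := sum_achi_dual (0 : V m); rewrite eqxx.
    rewrite (eq_bigr (fun=> 1)) => [|d _]; last exact: achi_at0.
    by rewrite sumr_const => /eqP; rewrite eqr_nat cardsE => /eqP->.
  by rewrite inE c1.
by case/imsetP=> v _ ->; exists v.
Qed.

(** Exactness at C_m: if T = id the cocycle is trivial and lambda is a character
    of V_m, hence of the form (-1)^<v, .>. *)
Lemma in_KV m (g : clifford m) : (g \in KV m) = (cT g == 1%g).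
Proof.
apply/imsetP/eqP => [[v _ ->] // | g1].
have gP : asp_pred (cpair g).
  apply/asp_predP; split; first exact: cT_Sp.
    by case/clifford_predP: (cpairP g).
  by move=> u v; rewrite -!/(lam g _) lamP g1 !autV1 /beta sgn_sq mul1r.
have [v /(congr1 (@achi m)) vE] := asp_char_onto (c := Asp gP) g1.
exists v => //; apply: clifford_ext => // x.
by have := congr1 (fun f => f x) vE; rewrite lamK /achi /= ffunE.
Qed.

(** Conjugating chi_u by g gives x |-> (-1)^<u,Tx>, which is the character of
    T^-1 u because T is an isometry; by nondegeneracy it equals chi_u only when
    T fixes u. *)
Lemma in_inertia m (g : clifford m) : (g \in inertia_nz m) = (cT g \in P m).
Proof.
rewrite in_setI inE /= in_P cT_Sp; have nKg : g \in 'N(KV m).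
  by apply: (subsetP (normal_norm (KV_normal m))); rewrite inE.
rewrite inE nKg /=.
have conjE x : (chiV (uvec m) ^ g)%CF (K x) = sgn (form (uvec m) (cT g x)).
  have cTV : cT g^-1%g = (cT g)^-1%g by [].
  by rewrite cfConjgE // K_conj cTV invgK chiVE.
apply/eqP/eqP=> [e | e].
  apply/eqP; rewrite -subr_eq0; apply/negPn/negP=> /form_nondeg[x /negP[]].
  have N1 (v : V m) : - v = v by apply: (addrI v); rewrite subrr V_addrr.
  rewrite N1 formDr !(formC x) -(autVKV (cT g) x).
  have /SpP-> := cT_Sp g; move: ((cT g)^-1%g x) => y; apply/eqP.
  have := conjE y; rewrite e chiVE => /sgn_inj<-; exact: F2_addrr.
apply/cfun_inP=> _ /imsetP[x _ ->]; rewrite conjE chiVE -{1}e.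
by have /SpP-> := cT_Sp g.
Qed.

(** The cocycle rule lambda_(gh)(u) = lambda_g(T_h u) lambda_h(u) is
    multiplicative once T_h fixes u. *)
Lemma inertia_char_repr m : mx_repr (inertia_nz m) (fun g => (lam g (uvec m))%:M : 'M[algC]_1).
Proof.
split=> [|g h _]; first by rewrite lam1.
rewrite in_inertia in_P lamM => /andP[_ /eqP->].
by rewrite scalar_mxM.
Qed.

Definition inertia_char m : 'CF(inertia_nz m) := cfRepr (MxRepresentation (inertia_char_repr m)).

Lemma inertia_charE m g : inertia_char m g = lam g (uvec m) *+ (g \in inertia_nz m).
Proof. by rewrite cfunE /= mxtrace_scalar mulr1n. Qed.

Lemma inertia_char_lin m : inertia_char m \is a linear_char.
Proof. by rewrite qualifE /= cfRepr_char cfRepr1 eqxx. Qed.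

Lemma KV_sub_inertia m : KV m \subset inertia_nz m.
Proof. by apply: sub_Inertia; apply: normal_sub (KV_normal m). Qed.

Lemma inertia_char_ext m : 'Res[KV m] (inertia_char m) = chiV (uvec m).
Proof.
apply/cfun_inP=> _ /imsetP[v _ ->]; have Kv : K v \in KV m by apply: imset_f.
rewrite cfResE ?KV_sub_inertia // inertia_charE (subsetP (KV_sub_inertia m)) // mulr1n lamK chiVE.
by rewrite formC.
Qed.

(** The kernel of [cT] is [KV] by [in_KV]; surjectivity is [clifford_lift]. *)
Lemma quotient_iso m : exists f : {morphism (inertia_nz m / KV m)%g >-> autV m},
  isom (inertia_nz m / KV m)%g (P m) f /\
  forall g, g \in inertia_nz m -> f (coset (KV m) g) = cT g.
Proof.
have cTmor : {in inertia_nz m &, {morph @cT m : g h / (g * h)%g}} by [].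
pose q := Morphism cTmor.
have kerq : 'ker q = 'ker (coset (KV m)).
  rewrite ker_coset; apply/setP=> g; rewrite in_KV.
  apply/idP/eqP => [/mker // | g1].
  by apply/kerP; rewrite ?in_inertia ?g1 ?group1.
have sker : 'ker (coset (KV m)) \subset 'ker q by rewrite kerq.
have sIN : inertia_nz m \subset 'N(KV m) := norm_Inertia _ _.
have fE g : g \in inertia_nz m -> factm sker sIN (coset (KV m) g) = cT g.
  by move=> Ig; rewrite (factmE sker sIN).
exists (factm_morphism sker sIN); split => //.
apply/isomP; split; first exact/injm_factmP.
rewrite morphim_factm; apply/setP=> T; apply/morphimP/idP => [[g _ Ig ->] | PT].
  by rewrite -in_inertia.
have [|g gT] := @clifford_lift m T; first by move: PT; rewrite in_P => /andP[].
by exists g; rewrite ?in_inertia ?gT.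
Qed.

(** * The nontrivial block *)

Lemma Sp_section_ex m : (0 < m)%N ->
  exists Tx : V m -> autV m, forall x, x != 0 -> Tx x \in Sp m /\ Tx x (uvec m) = x.
Proof.
move=> m0; exists (fun x => odflt 1%g [pick T in Sp m | T (uvec m) == x]) => x nx.
case: pickP => [T /andP[TSp /eqP] // | no].
have [T TSp Tx] := Sp_trans (uvec_neq0 m0) nx.
by have := no T; rewrite TSp Tx eqxx.
Qed.

(** By [chi_nz_columns] and [cfInd_columns], both sides are the same sum over the
    nonzero fixed points of [cT g]. *)
Lemma chi_nz_Ind m (f : {morphism (inertia_nz m / KV m)%g >-> autV m})
    (isof : isom (inertia_nz m / KV m)%g (P m) f) (b : Iirr (inertia_nz m / KV m)) :
    (0 < m)%N -> (forall g, g \in inertia_nz m -> f (coset (KV m) g) = cT g) ->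
  chi_nz (isom_Iirr isof b) =
    'Ind[[set: clifford m]] (('chi_b %% KV m)%CF * inertia_char m).
Proof.
move=> m0 fE; have [Tx TxP] := Sp_section_ex m0; apply/cfunP=> g.
rewrite (chi_nz_columns m0 TxP); symmetry.
apply: (cfInd_columns m0 TxP g (@cTM m) (@cT_Sp m) (@clifford_lift m) (@in_inertia m) _ (@lamJ m)).
have nKI : KV m <| inertia_nz m.
  by apply: normal_Inertia; apply: normal_sub (KV_normal m).
move=> h; rewrite cfunE inertia_charE mulrC; case Ih: (h \in inertia_nz m).
  by rewrite mulr1n cfModE // isom_IirrE -fE // cfIsomE // mem_quotient.
by rewrite mulr0n mul0r [X in _ * X]cfun0 ?mulr0 // -in_inertia Ih.
Qed.

(** A restriction from C_m is invariant under conjugation, so it has the same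
    product with every character of an orbit. *)
Lemma block_nzE m (phi : 'CF([set: clifford m])) :
  block_nz phi =
  (phi \in irr [set: clifford m]) && ('['Res[KV m] phi, chiV (uvec m)] != 0).
Proof.
rewrite /block_nz; congr (_ && _); apply/hasP/idP => [[_ /cfclassP[y Gy ->]] | nz].
  by rewrite cfdot_Res_conjg.
by exists (chiV (uvec m)) => //; apply: cfclass_refl.
Qed.

Theorem theorem4p7 (m : nat) (m_ge2 : (2 <= m)%N) :
  [/\ (forall phi : 'CF([set: clifford m]),
         block_nz phi <-> exists t : Iirr (P m), phi = chi_nz t)
      /\ injective (@chi_nz m),
      (* (T, lambda) |-> T induces an isomorphism from H_2 onto P_m *)
      exists f : {morphism (inertia_nz m / KV m)%g >-> autV m},
        isom (inertia_nz m / KV m)%g (P m) f /\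
        forall g, g \in inertia_nz m -> f (coset (KV m) g) = cT g,
      forall Tx : V m -> autV m,
        (forall x, x != 0 -> Tx x \in Sp m /\ Tx x (uvec m) = x) ->
        forall (t : Iirr (P m)) (g : clifford m),
          chi_nz t g =
          \sum_(x : fixed_space (cT g) | val x != 0)
             ell x * 'chi_t ((Tx (val x))^-1 * cT g * Tx (val x))%g
    & (* chi_{u_m} extends to an ordinary character of its inertia group *)
      exists2 psi : 'CF(inertia_nz m),
        psi \is a character & 'Res[KV m] psi = chiV (uvec m)].
Proof.
have m0 : (0 < m)%N := ltnW m_ge2.
have [f [isof fE]] := quotient_iso m.
have irr_u : chiV (uvec m) \in irr (KV m).
  by rewrite -inertia_char_ext; apply/lin_char_irr/cfRes_lin_char/inertia_char_lin.
have [Phi_inj Phi_irr] := irr_over_extendible (KV_normal m) irr_u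
  (lin_char_irr (inertia_char_lin m)) (inertia_char_ext m).
have chiE t : chi_nz t =
    'Ind[[set: clifford m]]
       (('chi_(isom_Iirr (isom_sym isof) t) %% KV m)%CF * inertia_char m).
  by rewrite -(chi_nz_Ind isof) // isom_IirrKV.
split.
- split=> [phi | t t']; last first.
    by rewrite !chiE => /Phi_inj/isom_Iirr_inj.
  rewrite block_nzE; split=> [/Phi_irr[b ->] | [t ->]].
    by exists (isom_Iirr isof b); rewrite (chi_nz_Ind isof).
  by apply/Phi_irr; exists (isom_Iirr (isom_sym isof) t).
- by exists f.
- move=> Tx TxP t g; rewrite (chi_nz_columns m0 TxP).
  rewrite (eq_bigl _ _ (fun x => andbC _ _)).
  exact: (big_sub_cond (fun x => cT g x == x) (fun x => x != 0)).
- by exists (inertia_char m); [apply: lin_charW (inertia_char_lin m) | apply: inertia_char_ext].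
Qed.
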